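(* Let $p$ be an odd prime and define $c_p(x)=x^{-1}\sum_{\ell=-\infty}^{\infty}p^{-\ell}\|p^\ell x\|^2$ for $x>0$. Let $x>0$ and put $k_j=[p^jx]$. Then as $j\to\infty$, $v_p(g_{k_j,U})\sim k_j\,c_p(x)$ and $v_p(g_{k_j,O})\sim v_p(g_{k_j,Sp})\sim\tfrac12 k_j\,c_p(x)$.
   Context: $\|t\|$ is the distance from $t$ to the nearest integer; $[t]$ is the floor of $t$; $v_p(n)$ is the exponent of $p$ in the rational number $n$. For $\lambda\in\mathbb{C}$ let $B_U(\lambda)=\lambda^2$, $B_O(\lambda)=\tfrac12\lambda(\lambda-1)$, $B_{Sp}(\lambda)=\tfrac12\lambda(\lambda+1)$. Define $G_U(\lambda)=\lim_{N\to\infty}N^{-\lambda^2}\prod_{j=1}^{N}\frac{\Gamma(j)\Gamma(j+2\lambda)}{\Gamma(j+\lambda)^2}$, $G_O(\lambda)=\tfrac12\lim_{N\to\infty}N^{-\lambda(\lambda-1)/2}\,2^{2N\lambda}\prod_{j=1}^{N}\frac{\Gamma(N+j-1)\Gamma(j-\frac12+\lambda)}{\Gamma(N+j-1+\lambda)\Gamma(j-\frac12)}$, $G_{Sp}(\lambda)=\lim_{N\to\infty}N^{-\lambda(\lambda+1)/2}\,2^{2N\lambda}\prod_{j=1}^{N}\frac{\Gamma(N+j+1)\Gamma(j+\frac12+\lambda)}{\Gamma(N+j+1+\lambda)\Gamma(j+\frac12)}$, and $g_{\lambda,X}=\Gamma(1+B_X(\lambda))G_X(\lambda)$ for $X\in\{U,O,Sp\}$.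 *)

(* Defs.v *)
From HB Require Import structures.
From mathcomp Require Import all_boot all_order all_algebra.
From mathcomp Require Import all_classical all_reals all_analysis.
Set Implicit Arguments. Unset Strict Implicit. Unset Printing Implicit Defensive.
Import Order.TTheory GRing.Theory Num.Theory numFieldNormedType.Exports.
Local Open Scope ring_scope.

Section Defs.
Variable R : realType.

Definition distZ (t : R) : R :=
  Order.min (t - (Num.floor t)%:~R) ((Num.ceil t)%:~R - t).

(* c_p(x) = x^{-1} \sum_{l in Z} p^{-l} ||p^l x||^2, the bilateral series
   split into l >= 0 and l = -m with m >= 1 *)
Definition cp (p : nat) (x : R) : R :=
  x^-1 * ( limn (fun n : nat => \sum_(l < n) ((p%:R : R) ^- l * distZ (p%:R ^+ l * x) ^+ 2))
         + limn (fun n : nat => \sum_(m < n) ((p%:R : R) ^+ m.+1 * distZ (p%:R ^- m.+1 * x) ^+ 2))).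

(* rising factorial a (a+1) ... (a+k-1) = Gamma(a+k)/Gamma(a) for a > 0 *)
Definition rf (a : R) (k : nat) : R := \prod_(i < k) (a + i%:R).

(* G_U(k), k natural: Gamma(j)Gamma(j+2k)/Gamma(j+k)^2 = rf j (2k) / (rf j k)^2 *)
Definition G_U (k : nat) : R :=
  limn (fun N : nat => (N%:R : R) ^- (k * k) *
     \prod_(1 <= j < N.+1) (rf j%:R (2 * k) / rf j%:R k ^+ 2)).

(* G_O(k): Gamma(N+j-1)/Gamma(N+j-1+k) = 1 / rf (N+j-1) k,
           Gamma(j-1/2+k)/Gamma(j-1/2) = rf (j-1/2) k *)
Definition G_O (k : nat) : R :=
  2^-1 * limn (fun N : nat => (N%:R : R) ^- (k * k.-1)./2 * 2 ^+ (2 * N * k) *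
     \prod_(1 <= j < N.+1) (rf (j%:R - 2^-1) k / rf (N%:R + j%:R - 1) k)).

(* G_Sp(k): Gamma(N+j+1)/Gamma(N+j+1+k) = 1 / rf (N+j+1) k,
            Gamma(j+1/2+k)/Gamma(j+1/2) = rf (j+1/2) k *)
Definition G_Sp (k : nat) : R :=
  limn (fun N : nat => (N%:R : R) ^- (k * k.+1)./2 * 2 ^+ (2 * N * k) *
     \prod_(1 <= j < N.+1) (rf (j%:R + 2^-1) k / rf (N%:R + j%:R + 1) k)).

(* g_{k,X} = Gamma(1 + B_X(k)) G_X(k) *)
Definition g_U (k : nat) : R := ((k * k)`!)%:R * G_U k.
Definition g_O (k : nat) : R := (((k * k.-1)./2)`!)%:R * G_O k.
Definition g_Sp (k : nat) : R := (((k * k.+1)./2)`!)%:R * G_Sp k.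

End Defs.

(* p-adic valuation of a rational number (0 for q = 0) *)
Definition vp_rat (p : nat) (q : rat) : int :=
  (logn p `|numq q|)%:Z - (logn p `|denq q|)%:Z.

(* p-adic valuation of a real number that is rational (0 otherwise) *)
Definition vp {R : realType} (p : nat) (r : R) : int :=
  vp_rat p (xget 0%R [set q : rat | r = ratr q]).

Definition kseq {R : realType} (p : nat) (x : R) (j : nat) : nat :=
  `|Num.floor (p%:R ^+ j * x)|%N.

(* Main.v *)
Require Import Defs.
From HB Require Import structures.
From mathcomp Require Import all_boot all_order all_algebra.
From mathcomp Require Import all_classical all_reals all_analysis.
From mathcomp Require Import zify ring lra.
Import Order.TTheory GRing.Theory Num.Theory numFieldNormedType.Exports.
Local Open Scope classical_set_scope.
Local Open Scope ring_scope.

(* For a natural number k the defining products telescope, so that each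
   g_{k,X} is a power of 2 times a quotient of products of factorials.
   By Legendre's formula its p-adic valuation is a sum over the powers
   q = p^l of expressions in the floors of i/q, and these sum to
   c q ||k/q||^2 + O(1) with c = 1 for U and c = 1/2 for O and Sp.  Only the
   O(j) powers q <= k_j^2 contribute, and t |-> ||t||^2 is 1-Lipschitz, so
   replacing k_j by p^j x costs O(j) in total and leaves p^j times a partial
   sum of the bilateral series defining x c_p(x). *)

(** * Floor sums and Legendre's formula *)

(** Induction on n: with n = a q + b the left side grows by 2 q a + q. So does the right side, both
    when b + 1 < q and when the residue wraps to 0, where b (q - b) falls from q - 1 to 0. *)
Lemma sum_divn (q n : nat) : (0 < q)%N ->
  (2 * q * (\sum_(i < n) i %/ q) + q * n = n ^ 2 + n %% q * (q - n %% q))%N.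
Proof.
move=> q0; elim: n => [|n IHn]; first by rewrite big_ord0 mod0n mul0n !muln0.
rewrite big_ord_recr /=.
have -> : (n.+1 %% q = if (n %% q).+1 < q then (n %% q).+1 else 0)%N.
  rewrite [in LHS](divn_eq n q) -addnS modnMDl.
  case: ltnP => h; first by rewrite modn_small.
  have /eqP -> : (n %% q).+1 == q by rewrite eqn_leq h ltn_pmod.
  exact: modnn.
move: IHn (divn_eq n q) (ltn_pmod n q0).
move: (\sum_(i < n) i %/ q)%N (n %/ q)%N (n %% q)%N => s a b + nE bq; rewrite nE.
(* Writing q as a sum removes the truncated subtraction; c = 0 is the case where the residue
   wraps. *)
have [c ->] : exists c, q = (b + c.+1)%N by exists (q - b.+1)%N; rewrite subnSK // subnKC // ltnW.
rewrite addKn -[X in (X < _)%N]addn1 ltn_add2l ltnS.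
case: c => [|c] /=; first by clear; lia.
have -> : (b + c.+2 - b.+1 = c.+1)%N by rewrite addnS subSS addKn.
by clear; lia.
Qed.

(* q ||k/q|| *)
Definition resid (k q : nat) : nat := minn (k %% q)%N (q - k %% q)%N.

Lemma modn_double (k q : nat) : (0 < q)%N ->
  ((k + k) %% q = if (k %% q).*2 < q then (k %% q).*2 else (k %% q).*2 - q)%N.
Proof.
move=> q0; rewrite -modnDm addnn; move: (k %% q)%N (ltn_pmod k q0) => b bq.
case: ltnP => h; first by rewrite modn_small.
by rewrite -[in LHS](subnK h) modnDr modn_small //; move: q0 bq h; clear; lia.
Qed.

(** Subtract twice [sum_divn] at k from [sum_divn] at 2k. With b and b' the residues of k and 2k,
    the remainder terms combine to b'(q - b') - 2b(q - b) = -2 min(b, q - b)^2, which is how the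
    squared distance to the nearest integer arises. *)
Lemma sum_divn_shift (k q : nat) : (0 < q)%N ->
  (q * (\sum_(i < k) (k + i) %/ q) + resid k q ^ 2 =
   q * (\sum_(i < k) i %/ q) + k ^ 2)%N.
Proof.
move=> q0; have := sum_divn q (k + k) q0; have := sum_divn q k q0.
rewrite big_split_ord /= modn_double // /resid.
move: (\sum_(i < k) i %/ q)%N (\sum_(i < k) (k + i) %/ q)%N => s t.
move: (k %% q)%N (ltn_pmod k q0) => b bq.
case: ltnP => hb.
  have -> : minn b (q - b) = b by move: hb; clear; lia.
  have [c ->] : exists c, q = (b.*2 + c)%N by exists (q - b.*2)%N; move: hb; clear; lia.
  have -> : (b.*2 + c - b = b + c)%N by clear; lia.
  by rewrite addKn; clear; lia.
have -> : minn b (q - b) = (q - b)%N by move: hb; clear; lia.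
(* Here c = q - b is the residual of k and d = 2b - q is the residue of 2k. *)
have [c [d [-> ->]]] : exists c d, b = (c + d)%N /\ q = (c + d + c)%N.
  by exists (q - b)%N, (b - (q - b))%N; move: bq hb; clear; lia.
have -> : (c + d + c - (c + d) = c)%N by clear; lia.
have -> : ((c + d).*2 - (c + d + c) = d)%N by clear; lia.
have -> : (c + d + c - d = c.*2)%N by clear; lia.
by clear; lia.
Qed.

(** Hermite's identity [2y] = [y] + [y + 1/2] at y = i/q with q = 2h + 1; the half step q/2 may be
    rounded down to h because the numerators are integers. *)
Lemma divn_double (h i : nat) :
  (i.*2 %/ h.*2.+1 = i %/ h.*2.+1 + (i + h) %/ h.*2.+1)%N.
Proof.
rewrite (divn_eq i h.*2.+1).
move: (i %/ _)%N (i %% _)%N (ltn_pmod i (isT : 0 < h.*2.+1)%N) => a b bq.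
rewrite -muln2 mulnDl mulnAC -addnA !divnMDl //.
have -> : (b %/ h.*2.+1 = 0)%N by rewrite divn_small.
have [hb|hb] := leqP b h.
  have -> : (b * 2 %/ h.*2.+1 = 0)%N by rewrite divn_small //; move: hb; clear; lia.
  have -> : ((b + h) %/ h.*2.+1 = 0)%N by rewrite divn_small //; move: hb; clear; lia.
  by clear; lia.
have -> : (b + h = h.*2.+1 + (b - h.+1))%N by move: hb; clear; lia.
have -> : (b * 2 = h.*2.+1 + (b * 2 - h.*2.+1))%N by move: hb; clear; lia.
rewrite !divnDl // !divnn /=.
have -> : ((b * 2 - h.*2.+1) %/ h.*2.+1 = 0)%N.
  by rewrite divn_small //; move: bq hb; clear; lia.
have -> : ((b - h.+1) %/ h.*2.+1 = 0)%N.
  by rewrite divn_small //; move: bq hb; clear; lia.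
by clear; lia.
Qed.

Lemma modn_shift_half (h n : nat) : ((h + n) %% h.*2.+1 =
  if n %% h.*2.+1 <= h then h + n %% h.*2.+1 else n %% h.*2.+1 - h.+1)%N.
Proof.
rewrite -modnDmr; move: (n %% _)%N (ltn_pmod n (isT : 0 < h.*2.+1)%N) => b bq.
case: leqP => hb; first by rewrite modn_small //; move: hb; clear; lia.
have -> : (h + b = (b - h.+1) + h.*2.+1)%N by move: hb; clear; lia.
by rewrite modnDr modn_small //; move: hb bq; clear; lia.
Qed.

(** By [divn_double] the summand is [(i + h)/q] with q = 2h + 1, so the sum is [sum_divn] at h + n,
    whose first h terms vanish. With b the residue of n, the middle expression without q is exactly
    n^2 + b if b <= h and n^2 - (q - b) otherwise. *)
Lemma sum_divn_double (n q : nat) : odd q ->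
  (2 * q * (\sum_(i < n) (i.*2 %/ q - i %/ q)) + resid n q ^ 2 + n
     <= n ^ 2 + q)%N /\
  (n ^ 2 <=
   2 * q * (\sum_(i < n) (i.*2 %/ q - i %/ q)) + resid n q ^ 2 + n + q)%N.
Proof.
move=> oq; have [h ->] : exists h, q = h.*2.+1.
  by exists q./2; rewrite -[LHS]odd_double_half oq.
have := sum_divn h.*2.+1 (h + n) isT.
rewrite big_split_ord /=.
have -> : (\sum_(i < h) i %/ h.*2.+1 = 0)%N.
  by apply: big1 => i _; rewrite divn_small //; case: i => /= i; clear; lia.
rewrite add0n (eq_bigr (fun i : 'I_n => i.*2 %/ h.*2.+1 - i %/ h.*2.+1)%N) => [|i _];
  last by rewrite divn_double addKn addnC.
rewrite modn_shift_half /resid; move: (\sum_(i < n) _)%N => T.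
move: (n %% _)%N (ltn_pmod n (isT : 0 < h.*2.+1)%N) => b bq.
case: leqP => hb.
  have -> : minn b (h.*2.+1 - b) = b by move: hb; clear; lia.
  have [c ->] : exists c, h = (b + c)%N by exists (h - b)%N; move: hb; clear; lia.
  have -> : ((b + c).*2.+1 - (b + c + b) = c.+1)%N by clear; lia.
  by clear; lia.
have [c [d [-> ->]]] : exists c d, h = (c + d)%N /\ b = ((c + d).+1 + c)%N.
  by exists (b - h.+1)%N, (h - (b - h.+1))%N; move: bq hb; clear; lia.
have -> : minn ((c + d).+1 + c) ((c + d).*2.+1 - ((c + d).+1 + c)) = d by clear; lia.
have -> : ((c + d).+1 + c - (c + d).+1 = c)%N by clear; lia.
have -> : ((c + d).*2.+1 - c = c + d.*2.+1)%N by clear; lia.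
by clear; lia.
Qed.

(** Legendre's formula cut at a level L that can be shared by all factorials of a quotient, so that
    their sums combine level by level. Levels whose power of p exceeds n contribute zero. *)
Lemma logn_fact_bounded (p n L : nat) : prime p -> (n < p ^ L.+1)%N ->
  logn p n`! = (\sum_(l < L) n %/ p ^ l.+1)%N.
Proof.
move=> pp nL; rewrite logn_fact //.
rewrite big_add1 /= big_mkord.
have cut a b : (a <= b)%N -> (n < p ^ a.+1)%N ->
    (\sum_(l < b) n %/ p ^ l.+1 = \sum_(l < a) n %/ p ^ l.+1)%N.
  move=> ab na; rewrite -(subnKC ab) big_split_ord /=.
  rewrite [X in (_ + X)%N]big1 ?addn0 // => i _; rewrite divn_small //.
  by apply: leq_trans na _; rewrite leq_exp2l ?prime_gt1 // ltnS leq_addr.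
have [Ln|nL'] := leqP L n; first exact: cut.
apply/esym/cut; first exact: ltnW.
by apply: ltn_trans (ltn_expl n (prime_gt1 pp)) _; rewrite ltn_exp2l ?prime_gt1.
Qed.

Lemma logn_prod (I : Type) (s : seq I) (p : nat) (F : I -> nat) :
  (forall i, 0 < F i)%N -> logn p (\prod_(i <- s) F i) = (\sum_(i <- s) logn p (F i))%N.
Proof.
move=> F0; elim: s => [|i s IHs]; first by rewrite !big_nil logn1.
by rewrite !big_cons lognM ?IHs // prodn_gt0.
Qed.

Lemma prod_fact_gt0 (k : nat) (f : nat -> nat) : (0 < \prod_(i < k) (f i)`!)%N.
Proof. by apply: prodn_gt0 => i; exact: fact_gt0. Qed.

Lemma logn_prod_fact (p L k : nat) (f : nat -> nat) : prime p ->
  (forall i, i < k -> f i < p ^ L.+1)%N ->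
  logn p (\prod_(i < k) (f i)`!) = (\sum_(l < L) \sum_(i < k) f i %/ p ^ l.+1)%N.
Proof.
move=> pp fL; rewrite exchange_big /= logn_prod => [|i]; last exact: fact_gt0.
by apply: eq_bigr => i _; apply: logn_fact_bounded => //; exact: fL.
Qed.

(** * Closed forms of the constants G_X *)

Section Limits.
Variable R : realType.
Implicit Types (k m n N : nat).

Lemma factr_neq0 n : n`!%:R != 0 :> R.
Proof. by rewrite pnatr_eq0 -lt0n fact_gt0. Qed.
#[local] Hint Resolve factr_neq0 : core.

Lemma factrS n : n.+1`!%:R = n.+1%:R * n`!%:R :> R.
Proof. by rewrite factS natrM. Qed.

Lemma rfS (a : R) m : rf a m.+1 = rf a m * (a + m%:R).
Proof. by rewrite /rf big_ord_recr. Qed.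

Lemma rf_natr n m : rf (n.+1%:R : R) m = (n + m)`!%:R / n`!%:R.
Proof.
elim: m => [|m IHm]; first by rewrite addn0 divff // /rf big_ord0.
by rewrite rfS IHm addnS factS natrM -natrD addSn; field.
Qed.

Lemma rf_natr_neq0 n m : rf (n.+1%:R : R) m != 0.
Proof. by rewrite rf_natr mulf_neq0 ?invr_eq0. Qed.

(** Each of the m factors, divided by n, is c + (a + i)/n. *)
Lemma cvg_rf_div (c a m : nat) :
  rf ((c * n + a)%:R : R) m / n%:R ^+ m @[n --> \oo] --> (c%:R ^+ m : R).
Proof.
rewrite -cvg_shiftS /=.
have inv0 : (n.+1%:R^-1 : R) @[n --> \oo] --> 0 by exact: cvg_harmonic.
have E n : rf ((c * n.+1 + a)%:R : R) m / n.+1%:R ^+ m =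
           \prod_(i < m) (c%:R + (a + i)%:R * n.+1%:R^-1).
  rewrite -[m in _ ^+ m]card_ord -prodr_const -prodf_div.
  apply: eq_bigr => i _.
  rewrite !natrD natrM; field.
  by rewrite nat1r pnatr_eq0.
under eq_fun do rewrite E.
rewrite -[X in _ ^+ X]card_ord -prodr_const.
apply: cvg_big => [|i _]; first exact: mul_continuous.
rewrite -[X in _ --> X]addr0 -[X in _ --> _ + X](mulr0 ((a + i)%:R)).
by apply: cvgD; [exact: cvg_cst|apply: cvgM => //; exact: cvg_cst].
Qed.

(** The common shape of the three products after telescoping in j: k factors, each a constant times
    a rising factorial of fixed length based near c N. The lengths [e i] add up to the exponent
    B_X(k) of N; c is 1 for U and 2 for O and Sp. *)
Lemma lim_prod_rf k (c : nat) (a e : nat -> nat) (b : nat -> R) (u : nat -> R) :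
  (forall n, u n.+1 = \prod_(i < k) (b i * rf ((c * n.+1 + a i)%:R : R) (e i))) ->
  limn (fun n => n%:R ^- (\sum_(i < k) e i) * u n) =
  \prod_(i < k) (b i * c%:R ^+ e i).
Proof.
move=> uE; apply/cvg_lim => //; rewrite -cvg_shiftS /=.
have E n : n.+1%:R ^- (\sum_(i < k) e i) * u n.+1 =
   \prod_(i < k) (b i * (rf ((c * n.+1 + a i)%:R : R) (e i) / n.+1%:R ^+ e i)).
  rewrite uE expr_sum -prodfV -big_split /=; apply: eq_bigr => i _.
  by rewrite mulrC mulrA.
under eq_fun do rewrite E.
apply: cvg_big => [|i _]; first exact: mul_continuous.
apply: cvgM; first exact: cvg_cst.
have := cvg_rf_div c (a i) (e i).
by rewrite -cvg_shiftS.
Qed.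

(** Numerators and denominators are both quotients of factorials; the part depending on N is kept as
    a rising factorial of length k, ready for [lim_prod_rf]. *)
Lemma prod_rf_ratio k (i N : nat) :
  \prod_(1 <= j < N.+1) (((j + k + i)%:R : R) / (j + i)%:R) =
  i`!%:R / (k + i)`!%:R * rf ((N + i.+1)%:R : R) k.
Proof.
rewrite addnS rf_natr; elim: N => [|N IHN].
  by rewrite big_geq // add0n (addnC i); field; rewrite !factr_neq0.
rewrite big_nat_recr //= IHN.
rewrite !addSn !factS !natrM (_ : (N + k + i = N + i + k)%N); last by lia.
by field; rewrite !factr_neq0 -natrD nat1r pnatr_eq0.
Qed.

Lemma G_UE k : G_U R k = \prod_(i < k) (i`!%:R / (k + i)`!%:R).
Proof.
rewrite /G_U; have -> : (k * k = \sum_(i < k) k)%N by rewrite sum_nat_const card_ord.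
rewrite (lim_prod_rf k 1 S (fun=> k) (fun i => i`!%:R / (k + i)`!%:R)) => [|n].
  by apply: eq_bigr => i _; rewrite expr1n mulr1.
under [RHS]eq_bigr do rewrite mul1n -prod_rf_ratio.
rewrite exchange_big /=.
rewrite [LHS]big_nat [RHS]big_nat; apply: eq_bigr => j /andP[j0 _].
(* The rising factorial of length 2k splits into two of length k, and the first cancels one of the
   two in the denominator. *)
rewrite mul2n -addnn [rf _ (k + k)]/rf big_split_ord /= -/(rf _ k).
rewrite expr2 invfM mulrACA divff ?mul1r; last first.
  by case: j j0 => // j _; exact: rf_natr_neq0.
rewrite /rf -prodf_div; apply: eq_bigr => i _.
by rewrite -!natrD addnA.
Qed.

(** With m = j + i, each factor 4 (m - 1/2) equals 2m (2m - 1) / m, a ratio of consecutive values of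
    (2m)!/m!. *)
Lemma prod_half (i N : nat) :
  2 ^+ (2 * N) * \prod_(1 <= j < N.+1) (j%:R - 2^-1 + i%:R) =
  ((N + i).*2`!%:R * i`!%:R) / ((N + i)`!%:R * i.*2`!%:R) :> R.
Proof.
elim: N => [|N IHN].
  by rewrite muln0 expr0 big_geq // add0n; field; rewrite !factr_neq0.
rewrite big_nat_recr //= mulnS addnC exprD mulrACA IHN.
rewrite addSn doubleS !factS !natrM.
have -> : (N + i).*2.+2%:R = 2 * (N + i).+1%:R :> R by rewrite -natrM; congr _%:R; lia.
have -> : (N + i).*2.+1%:R = 2 * (N + i).+1%:R - 1 :> R.
  by rewrite -natrM -(natrB _ (n:=1)); [congr _%:R|]; lia.
have -> : N.+1%:R = (N + i).+1%:R - i%:R :> R.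
  by rewrite -natrB; [congr _%:R|]; lia.
field; rewrite !factr_neq0.
by rewrite -natrD nat1r pnatr_eq0.
Qed.

Lemma prod_natr_shift n N :
  \prod_(1 <= j < N.+1) ((n + j)%:R : R) = (n + N)`!%:R / n`!%:R.
Proof.
elim: N => [|N IHN]; first by rewrite big_geq // addn0 divff.
by rewrite big_nat_recr //= IHN addnS factS natrM; field.
Qed.

Lemma sum_ord_id k : (\sum_(i < k) i = (k * k.-1)./2)%N.
Proof. by rewrite -(big_mkord xpredT id) bin2_sum bin2. Qed.

Lemma sum_ord_succ k : (\sum_(i < k) i.+1 = (k * k.+1)./2)%N.
Proof. by rewrite mulnC -(sum_ord_id k.+1) big_ord_recl. Qed.

Lemma prod_rf_div k N (f g : nat -> R) :
  2 ^+ (2 * N * k) * \prod_(1 <= j < N.+1) (rf (f j) k / rf (g j) k) =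
  \prod_(i < k) (2 ^+ (2 * N) * \prod_(1 <= j < N.+1) (f j + i%:R) /
                 \prod_(1 <= j < N.+1) (g j + i%:R)).
Proof.
under eq_bigr do rewrite -prodf_div.
rewrite exchange_big /= exprM.
rewrite -[X in _ ^+ X]card_ord -prodr_const -big_split /=.
by apply: eq_bigr => i _; rewrite prodf_div mulrA.
Qed.

(** For fixed i the product over j is (2N+2i)! (N+i-1)! i! / ((N+i)! (2N+i-1)! (2i)!). The factor
    2N+2i against N+i leaves 2, and the rest is a rising factorial of length i based at 2N+i. *)
Lemma G_OE k :
  G_O R k = 2^-1 * \prod_(i < k) (2 ^+ i.+1 * (i`!%:R / i.*2`!%:R)).
Proof.
rewrite /G_O -sum_ord_id; congr (_ * _).
under eq_fun do rewrite -mulrA.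
rewrite (lim_prod_rf k 2 id id (fun i => 2 * (i`!%:R / i.*2`!%:R))) => [|n].
  by apply: eq_bigr => i _; rewrite exprS; ring.
rewrite prod_rf_div; apply: eq_bigr => i _; rewrite prod_half.
have -> : \prod_(1 <= j < n.+2) (n.+1%:R + j%:R - 1 + i%:R : R) =
          \prod_(1 <= j < n.+2) ((n + i) + j)%:R.
  by apply: eq_bigr => j _; rewrite -natr1 !natrD; ring.
rewrite prod_natr_shift (_ : (2 * n.+1 + i = (2 * n + i).+2)%N); last by lia.
rewrite rf_natr.
rewrite (_ : (n + i + n.+1 = (2 * n + i).+1)%N); last by lia.
rewrite (_ : ((n.+1 + i).*2 = ((2 * n + i).+1 + i).+1)%N); last by lia.
rewrite addSn (factrS (n + i)) (factrS ((2 * n + i).+1 + i)).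
have -> : ((2 * n + i).+1 + i).+1%:R = 2 * (n + i).+1%:R :> R.
  by rewrite -natrM; congr _%:R; lia.
by field; rewrite !factr_neq0 -natrD nat1r pnatr_eq0.
Qed.

(** Since j + 1/2 + i = j - 1/2 + (i+1), [prod_half] applies at i+1. The factorials (N+i+1)! cancel
    and a rising factorial of length i+1 based at 2N+i+2 remains. *)
Lemma G_SpE k :
  G_Sp R k = \prod_(i < k) (2 ^+ i.+1 * (i.+1`!%:R / i.+1.*2`!%:R)).
Proof.
rewrite /G_Sp -sum_ord_succ.
under eq_fun do rewrite -mulrA.
rewrite (lim_prod_rf k 2 (fun i => i.+2) S (fun i => i.+1`!%:R / i.+1.*2`!%:R)) => [|n].
  by apply: eq_bigr => i _; rewrite mulrC.
rewrite prod_rf_div; apply: eq_bigr => i _.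
have -> : \prod_(1 <= j < n.+2) (n.+1%:R + j%:R + 1 + i%:R : R) =
          \prod_(1 <= j < n.+2) ((n + i).+2 + j)%:R.
  by apply: eq_bigr => j _; rewrite -!natr1 !natrD; ring.
have -> : \prod_(1 <= j < n.+2) (j%:R + 2^-1 + i%:R : R) =
          \prod_(1 <= j < n.+2) (j%:R - 2^-1 + i.+1%:R).
  by apply: eq_bigr => j _; rewrite -natr1; field.
rewrite prod_half prod_natr_shift.
rewrite (_ : (2 * n.+1 + i.+2 = (2 * n + i).+4)%N); last by lia.
rewrite rf_natr.
rewrite (_ : ((n + i).+2 + n.+1 = (2 * n + i).+3)%N); last by lia.
rewrite (_ : (n.+1 + i.+1 = (n + i).+2)%N); last by lia.
rewrite (_ : ((n + i).+2.*2 = (2 * n + i).+3 + i.+1)%N); last by lia.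
by field; rewrite !factr_neq0.
Qed.

End Limits.

(** * Valuations of the constants g_X *)

Lemma vp_rat_div (p a b : nat) : (0 < a)%N -> (0 < b)%N ->
  vp_rat p (a%:R / b%:R) = (logn p a)%:Z - (logn p b)%:Z.
Proof.
move=> a0 b0; rewrite /vp_rat; set q : rat := _ / _.
have bn0 : b%:R != 0 :> rat by rewrite pnatr_eq0 -lt0n.
have an0 : a%:R != 0 :> rat by rewrite pnatr_eq0 -lt0n.
have q0 : q != 0 by rewrite mulf_neq0 ?invr_eq0.
(* The fraction a/b need not be in lowest terms, so it is compared with the reduced one by cross
   multiplication. *)
have E : (`|numq q| * b = a * `|denq q|)%N.
  rewrite -[b]/(`|b%:Z|%N) -[a]/(`|a%:Z|%N) -!abszM; congr absz.
  apply: (@intr_inj rat); rewrite !rmorphM /= -!pmulrn.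
  have := divq_num_den q; rewrite {3}/q => /eqP.
  by rewrite eqr_div // ?intr_eq0 ?denq_neq0 // => /eqP.
have : (logn p `|numq q| + logn p b = logn p a + logn p `|denq q|)%N.
  by rewrite -!lognM ?absz_gt0 ?numq_eq0 ?denq_neq0 // E.
by lia.
Qed.

Section Valuation.
Variable R : realType.
Implicit Types k q n : nat.

Lemma vp_div (p a b : nat) : (0 < a)%N -> (0 < b)%N ->
  vp p (a%:R / b%:R : R) = (logn p a)%:Z - (logn p b)%:Z.
Proof.
move=> a0 b0; rewrite /vp -(vp_rat_div p a b) //; congr vp_rat.
have E : a%:R / b%:R = ratr (a%:R / b%:R) :> R by rewrite fmorph_div !rmorph_nat.
(* The default value of [xget] is ruled out by [E], and injectivity of [ratr] identifies the chosen
   rational with a/b. *)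
case: xgetP => [q _ /= /esym|/(_ (a%:R / b%:R))]; last by rewrite /= E.
by rewrite E => /fmorph_inj.
Qed.

(** One form for all three constants. Powers of 2 have valuation 0 because p is odd; the exponent
    [t] accommodates the factor 1/2 of G_O. *)
Lemma vp_fact_quot (p L k B s t : nat) (f g : nat -> nat) :
  prime p -> odd p -> (B < p ^ L.+1)%N ->
  (forall i, i < k -> f i < p ^ L.+1)%N -> (forall i, i < k -> g i < p ^ L.+1)%N ->
  (vp p (B`!%:R * (2 ^+ s * \prod_(i < k) ((f i)`!%:R / (g i)`!%:R) / 2 ^+ t) : R))%:~R =
  \sum_(l < L) ((B %/ p ^ l.+1)%:R + (\sum_(i < k) f i %/ p ^ l.+1)%:R
     - (\sum_(i < k) g i %/ p ^ l.+1)%:R) :> R.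
Proof.
move=> pp op BL fL gL.
have log2 m : logn p (2 ^ m) = 0%N.
  by rewrite lognX logn_prime //; case: eqP op => [->|_ _] //; rewrite muln0.
have -> : B`!%:R * (2 ^+ s * \prod_(i < k) ((f i)`!%:R / (g i)`!%:R) / 2 ^+ t) =
    (B`! * (2 ^ s * \prod_(i < k) (f i)`!))%:R / (2 ^ t * \prod_(i < k) (g i)`!)%:R :> R.
  rewrite prodf_div -!natr_prod !natrM !natrX; field.
  by rewrite pnatr_eq0 -lt0n prod_fact_gt0 expf_neq0 ?pnatr_eq0.
have pos2 m : (0 < 2 ^ m)%N by rewrite expn_gt0.
rewrite vp_div ?muln_gt0 ?fact_gt0 ?pos2 ?prod_fact_gt0 //.
rewrite !lognM ?muln_gt0 ?fact_gt0 ?pos2 ?prod_fact_gt0 // !log2 !add0n.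
rewrite (logn_fact_bounded p B L) // !(logn_prod_fact p L) //.
by rewrite rmorphB /= -!pmulrn natrD !natr_sum -sumrN -!big_split.
Qed.

Lemma vp_g_U (p k L : nat) : prime p -> odd p ->
  (k * k < p ^ L.+1)%N -> (k.*2 < p ^ L.+1)%N ->
  (vp p (g_U R k))%:~R = \sum_(l < L) (((k * k) %/ p ^ l.+1)%:R +
     (\sum_(i < k) i %/ p ^ l.+1)%:R - (\sum_(i < k) (k + i) %/ p ^ l.+1)%:R) :> R.
Proof.
move=> pp op kL1 kL2.
rewrite -(vp_fact_quot p L k (k * k) 0 0 id (addn k)) => // [|i ik|i ik].
- by rewrite /g_U G_UE mul1r divr1.
- by apply: leq_ltn_trans kL2; move: ik; clear; lia.
- by apply: leq_ltn_trans kL2; move: ik; clear; lia.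
Qed.

Lemma prod_exp2 (k : nat) (F : nat -> R) :
  \prod_(i < k) (2 ^+ i.+1 * F i) = 2 ^+ (\sum_(i < k) i.+1) * \prod_(i < k) F i.
Proof. by rewrite big_split /= expr_sum. Qed.

Lemma sum_double_natr (n q : nat) :
  (\sum_(i < n) (i.*2 %/ q - i %/ q))%:R =
  (\sum_(i < n) i.*2 %/ q)%:R - (\sum_(i < n) i %/ q)%:R :> R.
Proof.
rewrite sumnB => [|i _]; last by rewrite leq_div2r // -addnn leq_addr.
by rewrite natrB // leq_sum // => i _; rewrite leq_div2r // -addnn leq_addr.
Qed.

Lemma vp_g_O (p k L : nat) : prime p -> odd p ->
  ((k * k.-1)./2 < p ^ L.+1)%N -> (k.*2 < p ^ L.+1)%N ->
  (vp p (g_O R k))%:~R = \sum_(l < L) ((((k * k.-1)./2) %/ p ^ l.+1)%:R -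
     (\sum_(i < k) (i.*2 %/ p ^ l.+1 - i %/ p ^ l.+1))%:R) :> R.
Proof.
move=> pp op kL1 kL2.
under eq_bigr do rewrite sum_double_natr opprB addrA.
rewrite -(vp_fact_quot p L k _ (\sum_(i < k) i.+1) 1 id double) => // [|i ik|i ik].
- by rewrite /g_O G_OE (prod_exp2 k (fun i => i`!%:R / i.*2`!%:R)) expr1 (mulrC 2^-1).
- by apply: leq_ltn_trans kL2; move: ik; clear; lia.
- by apply: leq_ltn_trans kL2; move: ik; clear; lia.
Qed.

(** The factorials have indices 1 to k; adding index 0, whose term vanishes, gives the orthogonal
    sum over i < k plus the term i = k. *)
Lemma vp_g_Sp (p k L : nat) : prime p -> odd p ->
  ((k * k.+1)./2 < p ^ L.+1)%N -> (k.*2 < p ^ L.+1)%N ->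
  (vp p (g_Sp R k))%:~R = \sum_(l < L) ((((k * k.+1)./2) %/ p ^ l.+1)%:R -
     (\sum_(i < k.+1) (i.*2 %/ p ^ l.+1 - i %/ p ^ l.+1))%:R) :> R.
Proof.
move=> pp op kL1 kL2.
under eq_bigr do rewrite sum_double_natr opprB addrA big_ord_recl [in X in _ - X]big_ord_recl /=.
under eq_bigr do rewrite !div0n !add0n.
rewrite -(vp_fact_quot p L k _ (\sum_(i < k) i.+1) 0 S (double \o S)) => // [|i ik|i ik].
- by rewrite /g_Sp G_SpE (prod_exp2 k (fun i => i.+1`!%:R / i.+1.*2`!%:R)) expr0 divr1.
- by apply: leq_ltn_trans kL2; move: ik; clear; lia.
- by apply: leq_ltn_trans kL2; move: ik => /=; clear; lia.
Qed.
End Valuation.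

(** * Distance to the nearest integer *)

Section DistZ.
Variable R : realType.
Implicit Types (s t : R) (m : int) (k q : nat).

Lemma distZ_eq t : exists m, distZ t = `|t - m%:~R|.
Proof.
have := floor_itv t; have := ceil_itv t; rewrite !rmorphD /= => /andP[_ c2] /andP[f1 _].
rewrite /distZ /Order.min; case: ifP => _.
  by exists (Num.floor t); rewrite ger0_norm // subr_ge0.
by exists (Num.ceil t); rewrite distrC ger0_norm // subr_ge0.
Qed.

Lemma distZ_le t m : distZ t <= `|t - m%:~R|.
Proof.
rewrite /distZ ge_min; case: (lerP m%:~R t) => h.
  apply/orP; left; rewrite lerD2l lerN2.
  by rewrite ler_int floor_ge_int.
apply/orP; right; rewrite lerD2r.
by rewrite ler_int ceil_le_int ltW.
Qed.

Lemma distZ_ge0 t : 0 <= distZ t.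
Proof. by have [m ->] := distZ_eq t. Qed.

Lemma distZ_le_half t : distZ t <= 2^-1.
Proof.
have := floor_itv t; rewrite rmorphD /= => /andP[f1 f2].
have := distZ_le t (Num.floor t); rewrite ger0_norm ?subr_ge0 // => h1.
have := distZ_le t (Num.floor t + 1).
by rewrite rmorphD distrC ger0_norm => [h2|]; [lra|rewrite subr_ge0 ltW].
Qed.

(** If another integer n realises the distance, then 1 <= |n - m| <= |t - m| + |t - n| with both
    terms at most 1/2, so the two are equal. *)
Lemma distZ_near t m : `|t - m%:~R| <= 2^-1 -> distZ t = `|t - m%:~R|.
Proof.
have [n tn] := distZ_eq t; have := distZ_le t m; rewrite tn.
have [->//|mn] := eqVneq n m; move=> h1 h2; apply/le_anti; rewrite h1 /=.
have : 1 <= `|n%:~R - m%:~R : R|.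
  rewrite -rmorphB -intr_norm -[1]/(1%:~R) ler_int.
  by rewrite -gtz0_ge1 normr_gt0 subr_eq0.
have := ler_normB (t - m%:~R) (t - n%:~R).
have -> : t - m%:~R - (t - n%:~R) = n%:~R - m%:~R by ring.
by move=> *; lra.
Qed.

Lemma distZ_lipschitz s t : `|distZ s - distZ t| <= `|s - t|.
Proof.
have le (u v : R) : distZ u - distZ v <= `|u - v|.
  have [m ->] := distZ_eq v; rewrite lerBlDr (le_trans (distZ_le u m)) //.
  by have := ler_normD (u - v) (v - m%:~R); rewrite addrA subrK.
by rewrite ler_norml lerNl opprB le distrC le.
Qed.

(** Factor the difference of squares: the two distances add up to at most 1. *)
Lemma distZ_sqr_lipschitz s t : `|distZ s ^+ 2 - distZ t ^+ 2| <= `|s - t|.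
Proof.
rewrite subr_sqr normrM -[leRHS]mulr1 ler_pM ?distZ_lipschitz //.
rewrite ger0_norm ?addr_ge0 ?distZ_ge0 //.
by have := distZ_le_half s; have := distZ_le_half t; lra.
Qed.

Lemma distZ_le_norm t : distZ t <= `|t|.
Proof. by have := distZ_le t 0; rewrite subr0. Qed.

Lemma distZ_small t : 0 <= t <= 2^-1 -> distZ t = t.
Proof.
by move=> /andP[t0 t1]; rewrite (distZ_near t 0) subr0 ger0_norm.
Qed.

Lemma distZ_ratio k q : (0 < q)%N -> distZ (k%:R / q%:R : R) = (resid k q)%:R / q%:R.
Proof.
move=> q0; have qR : 0 < q%:R :> R by rewrite ltr0n.
have rq := ltn_pmod k q0; rewrite /resid.
have kE : k%:R / q%:R = (k %/ q)%:R + (k %% q)%:R / q%:R :> R.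
  by rewrite {1}(divn_eq k q) natrD natrM mulrDl mulfK ?gt_eqF.
have [h|h] := leqP (k %% q) (q - k %% q).
  have E : k%:R / q%:R - (k %/ q)%N%:~R = (k %% q)%:R / q%:R :> R.
    by rewrite kE -pmulrn; ring.
  rewrite (distZ_near _ (k %/ q)%N) E ger0_norm ?divr_ge0 //.
  rewrite ler_pdivrMr // mulrC ler_pdivlMr // -natrM ler_nat.
  by move: (k %% q)%N h rq; clear; lia.
have E : k%:R / q%:R - (k %/ q).+1%N%:~R = - ((q - k %% q)%:R / q%:R) :> R.
  rewrite kE natrB 1?ltnW // -pmulrn -natr1; field.
  by rewrite gt_eqF.
rewrite (distZ_near _ (k %/ q).+1%N) E normrN ger0_norm ?divr_ge0 //.
rewrite ler_pdivrMr // mulrC ler_pdivlMr // -natrM ler_nat.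
by move: (k %% q)%N h rq; clear; lia.
Qed.

(** * Contribution of a single power q of p *)

Lemma mul_distZ_ratio k q : (0 < q)%N ->
  q%:R * distZ (k%:R / q%:R : R) ^+ 2 = (resid k q)%:R ^+ 2 / q%:R.
Proof.
move=> q0; rewrite distZ_ratio //; field.
by rewrite pnatr_eq0 -lt0n.
Qed.

Lemma divn_bounds k q : (0 < q)%N ->
  q%:R * (k %/ q)%:R <= k%:R :> R /\ k%:R <= q%:R * (k %/ q)%:R + q%:R :> R.
Proof.
move=> q0; rewrite -natrM -natrD !ler_nat [in X in _ /\ (X <= _)%N](divn_eq k q).
by rewrite mulnC leq_divM leq_add2l ltnW ?ltn_pmod.
Qed.

(** After multiplication by q, [sum_divn_shift] leaves only the rounding error of [k^2/q]. The bound
    3 is chosen to serve all three families. *)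
Lemma level_estimate_U k q : (0 < q)%N ->
  `| ((k * k) %/ q)%:R + (\sum_(i < k) i %/ q)%:R - (\sum_(i < k) (k + i) %/ q)%:R
     - q%:R * distZ (k%:R / q%:R : R) ^+ 2 | <= 3.
Proof.
move=> q0; have qR : 0 < q%:R :> R by rewrite ltr0n.
rewrite mul_distZ_ratio //.
have := congr1 (fun n => n%:R : R) (sum_divn_shift k q q0).
rewrite /= !natrD !natrX !natrM => E.
have [b1 b2] := divn_bounds (k * k) q q0; rewrite natrM in b1 b2.
move: ((k * k) %/ q)%:R (\sum_(i < k) i %/ q)%:R (\sum_(i < k) (k + i) %/ q)%:R
  ((resid k q)%:R ^+ 2) E b1 b2 => a b c d E b1 b2.
rewrite -(ler_pM2l qR) -[X in X * _ <= _](ger0_norm (ltW qR)) -normrM.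
have -> : q%:R * (a + b - c - d / q%:R) = q%:R * a + q%:R * b - q%:R * c - d.
  by field; rewrite gt_eqF.
rewrite ler_norml; apply/andP; split; rewrite -?expr2 in E b1 b2; lra.
Qed.

Lemma halfK_natr k : (k * k.-1)./2%:R = k%:R * (k%:R - 1) / 2 :> R.
Proof.
case: k => [|k]; first by rewrite !mul0r.
have -> : k.+1%:R * (k.+1%:R - 1) = (k.+1 * k)%:R :> R by rewrite natrM -natr1 addrK.
rewrite -[in RHS](odd_double_half (k.+1 * k)) oddM /= andNb add0n -muln2 natrM mulfK //.
Qed.

Lemma level_estimate_O k q : odd q ->
  `| ((k * k.-1)./2 %/ q)%:R - (\sum_(i < k) (i.*2 %/ q - i %/ q))%:R
     - 2^-1 * (q%:R * distZ (k%:R / q%:R : R) ^+ 2) | <= 3.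
Proof.
move=> oq; have q0 := odd_gt0 oq; have qR : 0 < q%:R :> R by rewrite ltr0n.
rewrite mul_distZ_ratio //.
have [] := sum_divn_double k q oq.
rewrite -!(ler_nat R) !natrD !natrX !natrM => e1 e2.
have [b1 b2] := divn_bounds (k * k.-1)./2 q q0; rewrite halfK_natr in b1 b2.
move: (_ %/ q)%:R (\sum_(i < k) _)%:R ((resid k q)%:R ^+ 2) e1 e2 b1 b2 => a b d e1 e2 b1 b2.
rewrite -(ler_pM2l qR) -[X in X * _ <= _](ger0_norm (ltW qR)) -normrM.
have -> : q%:R * (a - b - 2^-1 * (d / q%:R)) = q%:R * a - q%:R * b - d / 2.
  by field; rewrite gt_eqF.
rewrite ler_norml; apply/andP; split; nra.
Qed.

(** Compared with the orthogonal case, B grows by k, while the extra term [2k/q] - [k/q] is k/q up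
    to 1; after division by q the two changes cancel up to a bounded error. *)
Lemma level_estimate_Sp k q : odd q ->
  `| ((k * k.+1)./2 %/ q)%:R - (\sum_(i < k.+1) (i.*2 %/ q - i %/ q))%:R
     - 2^-1 * (q%:R * distZ (k%:R / q%:R : R) ^+ 2) | <= 3.
Proof.
move=> oq; have q0 := odd_gt0 oq; have qR : 0 < q%:R :> R by rewrite ltr0n.
rewrite mul_distZ_ratio // big_ord_recr /= natrD natrB; last first.
  by rewrite leq_div2r // -addnn leq_addr.
have [] := sum_divn_double k q oq.
rewrite -!(ler_nat R) !natrD !natrX !natrM => e1 e2.
have [b1 b2] := divn_bounds (k.+1 * k.+1.-1)./2 q q0; rewrite halfK_natr /= mulnC -natr1 in b1 b2.
have [c1 c2] := divn_bounds k q q0.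
have [d1 d2] := divn_bounds k.*2 q q0; rewrite -mul2n natrM mul2n in d1 d2.
move: (_ %/ q)%:R (\sum_(i < k) _)%:R ((resid k q)%:R ^+ 2) (k %/ q)%:R (k.*2 %/ q)%:R
   e1 e2 b1 b2 c1 c2 d1 d2 => a b d u v e1 e2 b1 b2 c1 c2 d1 d2.
rewrite -(ler_pM2l qR) -[X in X * _ <= _](ger0_norm (ltW qR)) -normrM.
have -> : q%:R * (a - (b + (v - u)) - 2^-1 * (d / q%:R)) =
   q%:R * a - q%:R * b - q%:R * v + q%:R * u - d / 2.
  by field; rewrite gt_eqF.
rewrite ler_norml; apply/andP; split; nra.
Qed.
End DistZ.

(** * Asymptotics *)

Lemma is_cvg_sum_geometric (R : realType) (u : nat -> R) (a z : R) :
  0 <= a -> 0 <= z < 1 -> (forall n, 0 <= u n <= a * z ^+ n) ->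
  cvgn (fun n => \sum_(i < n) u i).
Proof.
move=> a0 /andP[z0 z1] u_le.
under eq_fun do rewrite -(big_mkord xpredT u).
apply: (@series_le_cvg _ u (geometric a z)) => [n|n|n|].
- by case/andP: (u_le n).
- by rewrite /= mulr_ge0 ?exprn_ge0.
- by case/andP: (u_le n).
- by apply: is_cvg_geometric_series; rewrite ger0_norm.
Qed.

Section Asymptotics.
Variables (R : realType) (p : nat) (x : R).
Hypotheses (p_prime : prime p) (p_odd : odd p) (x_gt0 : 0 < x).

Let A (n : nat) : R := \sum_(l < n) ((p%:R : R) ^- l * distZ (p%:R ^+ l * x) ^+ 2).
Let B (n : nat) : R :=
  \sum_(m < n) ((p%:R : R) ^+ m.+1 * distZ (p%:R ^- m.+1 * x) ^+ 2).

Let p_ge3 : (3 <= p)%N.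
Proof. exact: odd_prime_gt2. Qed.

Let pR_gt0 : 0 < p%:R :> R.
Proof. by rewrite ltr0n prime_gt0. Qed.

Let pX_gt0 n : 0 < p%:R ^+ n :> R.
Proof. exact: exprn_gt0. Qed.

Let pX_ge0 n : 0 <= p%:R ^+ n :> R.
Proof. exact: ltW. Qed.

Let pXV_ge0 n : 0 <= p%:R ^- n :> R.
Proof. by rewrite invr_ge0. Qed.

Let pV_itv : 0 <= (p%:R^-1 : R) < 1.
Proof. by rewrite invr_ge0 ltW //= invf_lt1 // ltr1n prime_gt1. Qed.

Lemma is_cvg_cp_pos : cvgn A.
Proof.
apply: (is_cvg_sum_geometric _ (fun l => p%:R ^- l * distZ (p%:R ^+ l * x) ^+ 2) 1 p%:R^-1) => // n.
rewrite mulr_ge0 ?sqr_ge0 //= mul1r exprVn.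
rewrite ler_piMr // exprn_ile1 ?distZ_ge0 //.
by rewrite (le_trans (distZ_le_half _ _)) // invf_le1 // ler1n prime_gt0.
Qed.

(** Since ||t|| <= |t|, the m-th term is at most x^2 p^(-m-1). *)
Lemma is_cvg_cp_neg : cvgn B.
Proof.
apply: (is_cvg_sum_geometric _
    (fun m => p%:R ^+ m.+1 * distZ (p%:R ^- m.+1 * x) ^+ 2) (x ^+ 2 * p%:R^-1) p%:R^-1) => // [|n].
  by rewrite mulr_ge0 ?sqr_ge0 ?invr_ge0 ?ltW.
have pn0 := pX_gt0 n.+1; have pVn0 := pXV_ge0 n.+1; have x0 := ltW x_gt0.
rewrite mulr_ge0 ?sqr_ge0 //= -mulrA -exprS exprVn.
rewrite -ler_pdivlMl // (le_trans (_ : _ <= (p%:R ^- n.+1 * x) ^+ 2)) //.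
  rewrite ler_sqr ?nnegrE ?distZ_ge0 // ?mulr_ge0 //.
  by rewrite (le_trans (distZ_le_norm _ _)) // ger0_norm // mulr_ge0.
by rewrite exprMn [(p%:R ^- _) ^+ 2]expr2 -mulrA (mulrC _ (x ^+ 2)).
Qed.

Lemma exists_expn_ge : exists C : nat, x <= p%:R ^+ C.
Proof.
exists (Num.truncn x).+1; rewrite -natrX.
rewrite (le_trans (ltW (truncnS_gt x))) // ler_nat ltnW //.
by rewrite ltn_expl ?prime_gt1.
Qed.

Lemma nondecreasing_A : nondecreasing_seq A.
Proof.
apply/nondecreasing_seqP => n; rewrite /A big_ord_recr /= lerDl.
by rewrite mulr_ge0 ?sqr_ge0.
Qed.

Lemma nondecreasing_B : nondecreasing_seq B.
Proof.
apply/nondecreasing_seqP => n; rewrite /B big_ord_recr /= lerDl.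
by rewrite mulr_ge0 ?sqr_ge0.
Qed.

(** All terms are nonnegative. If x <= p^C then p^(-C-1) x is at most 1/2, hence equal to its
    distance to the integers, and gives a positive term. *)
Lemma cp_gt0 : 0 < cp p x.
Proof.
rewrite /cp mulr_gt0 ?invr_gt0 // -/A -/B ltr_wpDl //.
  apply: le_trans (nondecreasing_cvgn_le nondecreasing_A is_cvg_cp_pos 0).
  by rewrite /A big_ord0.
have [C xC] := exists_expn_ge.
rewrite (lt_le_trans _ (nondecreasing_cvgn_le nondecreasing_B is_cvg_cp_neg C.+1)) //.
rewrite /B big_ord_recr /= ltr_wpDl //.
  by apply: sumr_ge0 => i _; rewrite mulr_ge0 ?sqr_ge0.
have pC0 := pX_gt0 C.+1; have pVC0 := pXV_ge0 C.+1; have x0 := ltW x_gt0.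
rewrite mulr_gt0 // exprn_gt0 // distZ_small ?mulr_gt0 ?invr_gt0 //.
rewrite mulr_ge0 //= ler_pdivrMl // exprS.
have : 2 * x <= p%:R * p%:R ^+ C.
  by rewrite ler_pM // ler_nat ltnW.
by lra.
Qed.

(** The first j levels, read in reverse order, give the nonnegative powers p^(j-l-1) x of the
    bilateral series; the other m give the negative ones. *)
Lemma sum_scaled_distZ (j m : nat) :
  \sum_(l < j + m) (p%:R ^+ l.+1 * distZ (p%:R ^+ j * x / p%:R ^+ l.+1) ^+ 2) =
  p%:R ^+ j * (A j + B m).
Proof.
have p0 n : p%:R ^+ n != 0 :> R by rewrite expf_neq0 ?gt_eqF.
rewrite big_split_ord /= mulrDr /A /B !mulr_sumr; congr (_ + _).
  rewrite (reindex_inj rev_ord_inj) /=; apply: eq_bigr => -[i ij] _ /=.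
  rewrite subnSK //.
  have -> : p%:R ^+ j = p%:R ^+ (j - i) * p%:R ^+ i :> R by rewrite -exprD subnK // ltnW.
  by rewrite [in RHS]mulrA mulfK // -(mulrA _ _ x) mulrAC mulfV // mul1r.
apply: eq_bigr => i _; rewrite -addnS exprD -mulrA; congr (_ * (_ * distZ _ ^+ 2)).
by field; rewrite !p0.
Qed.

Let k := kseq p x.

Lemma kseq_itv j : (k j)%:R <= p%:R ^+ j * x < (k j)%:R + 1.
Proof.
have := floor_itv (p%:R ^+ j * x); rewrite /k /kseq.
rewrite rmorphD /= natr_absz ger0_norm //.
by rewrite floor_ge0 mulr_ge0 // ltW.
Qed.

(** Here k_j <= p^(j+C) and p^(L+1) is p times the square of that bound; the spare factor p >= 3
    gives strictness and covers 2 k_j. The shape of L matches [sum_scaled_distZ]. *)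
Lemma kseq_bounds (C j : nat) : x <= p%:R ^+ C -> let L := (j + (j + C.*2))%N in
  (k j * k j < p ^ L.+1)%N /\ ((k j).*2 < p ^ L.+1)%N.
Proof.
move=> xC L; have kC : (k j <= p ^ (j + C))%N.
  rewrite -(ler_nat R) natrX exprD; have /andP[h _] := kseq_itv j.
  by rewrite (le_trans h) // ler_pM2l // exprn_gt0.
have LE : (p ^ L.+1 = p * (p ^ (j + C) * p ^ (j + C)))%N.
  by rewrite expnS -expnD; congr (_ * p ^ _)%N; rewrite /L; clear; lia.
have P0 : (0 < p ^ (j + C))%N by rewrite expn_gt0 prime_gt0.
rewrite {}LE; move: (k j) (p ^ (j + C))%N kC P0 p_ge3 => n P nP P0 p3.
have PP : (3 * (P * P) <= p * (P * P))%N by rewrite leq_mul.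
have nn : (n * n <= P * P)%N by rewrite leq_mul.
have nP' : (n * 1 <= P * P)%N by rewrite leq_mul.
have P1 : (1 * 1 <= P * P)%N by rewrite leq_mul.
split; apply: leq_trans PP.
- by move: nn P1; clear; lia.
- by move: nP' P1; clear; lia.
Qed.

Lemma cvg_kseq : (k j)%:R / p%:R ^+ j @[j --> \oo] --> x.
Proof.
have z0 : (fun j => x - p%:R^-1 ^+ j) @ \oo --> x.
  rewrite -[X in _ --> X]subr0; apply: cvgB; first exact: cvg_cst.
  by apply: cvg_expr; case/andP: pV_itv => ? ?; rewrite ger0_norm.
apply: (squeeze_cvgr _ z0 (cvg_cst x)); apply: nearW => j.
have /andP[h1 h2] := kseq_itv j.
have pj : 0 < p%:R ^+ j :> R by rewrite exprn_gt0.
rewrite ler_pdivlMr // ler_pdivrMr // mulrBl exprVn mulVf ?gt_eqF // !(mulrC x).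
by rewrite h1 andbT; lra.
Qed.

(** As j <= 2^j and 1 <= 2^j, the quotient is dominated by a multiple of (2/p)^j, and p >= 3. *)
Lemma cvg_linear_div_expr (a b : R) :
  (a * j%:R + b) / p%:R ^+ j @[j --> \oo] --> (0 : R).
Proof.
have z_itv : `|2 / p%:R : R| < 1.
  by rewrite ger0_norm ?divr_ge0 // ltr_pdivrMr // mul1r ltr_nat.
apply/norm_cvg0P/(@squeeze_cvgr _ _ _ _ (cst 0) (fun j => (`|a| + `|b|) * (2 / p%:R) ^+ j)).
- apply: nearW => j; rewrite normr_ge0 /= normrM normfV.
  rewrite (ger0_norm (ltW (exprn_gt0 j pR_gt0))) expr_div_n mulrA ler_pM2r ?invr_gt0 ?exprn_gt0 //.
  rewrite mulrDl (le_trans (ler_normD _ _)) // lerD // ?normrM.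
    by rewrite ler_wpM2l // normr_nat -natrX ler_nat ltnW // ltn_expl.
  by rewrite ler_peMr // -natrX ler1n expn_gt0.
- exact: cvg_cst.
- rewrite -[X in _ --> X](mulr0 (`|a| + `|b|)).
  by apply: cvgM; [exact: cvg_cst|exact: cvg_expr].
Qed.

Lemma cvg_valuation_ratio (c : R) (C : nat) (v : nat -> R) : 0 < c <= 1 ->
  (forall j, `|v j - c * \sum_(l < j + (j + C))
      (p%:R ^+ l.+1 * distZ ((k j)%:R / p%:R ^+ l.+1) ^+ 2)| <= 3 * (j + (j + C))%:R) ->
  v j / (c * (k j)%:R * cp p x) @[j --> \oo] --> (1 : R).
Proof.
move=> /andP[c0 c1] v_near.
(* The numerator is 4 (2j + C): 3 per level from the hypothesis, and 1 per level for replacing k_j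
   by p^j x. *)
have err j : `|v j / p%:R ^+ j - c * (A j + B (j + C))| <=
    (8 * j%:R + 4 * C%:R) / p%:R ^+ j.
  rewrite ler_pdivlMr // -[X in _ * X](ger0_norm (pX_ge0 j)) -normrM mulrBl.
  rewrite divfK ?gt_eqF // -mulrA (mulrC _ (p%:R ^+ j)) -sum_scaled_distZ.
  apply: le_trans (ler_distD (c * \sum_(l < j + (j + C))
    (p%:R ^+ l.+1 * distZ ((k j)%:R / p%:R ^+ l.+1) ^+ 2)) _ _) _.
  have -> : 8 * j%:R + 4 * C%:R = 3 * (j + (j + C))%:R + (j + (j + C))%:R :> R.
    by rewrite !natrD; ring.
  rewrite lerD ?v_near // -mulrBr normrM gtr0_norm //.
  rewrite (le_trans (ler_piMl _ c1)) // -sumrB (le_trans (ler_norm_sum _ _ _)) //.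
  rewrite -[X in _ <= X%:R]card_ord -sumr_const; apply: ler_sum => l _.
  rewrite -mulrBr normrM (ger0_norm (pX_ge0 _)).
  (* The weight q = p^(l+1) cancels the q in the Lipschitz bound |k_j - p^j x| / q, leaving |k_j -
     p^j x| <= 1. *)
  rewrite (le_trans (ler_wpM2l (pX_ge0 _) (distZ_sqr_lipschitz _ _ _))) //.
  rewrite -mulrBl normrM normfV (ger0_norm (pX_ge0 _)) mulrC divfK ?gt_eqF //.
  have /andP[h1 h2] := kseq_itv j; rewrite distrC ger0_norm ?subr_ge0 //.
  by rewrite lerBlDl ltW.
have lim_v : v j / p%:R ^+ j @[j --> \oo] --> c * (limn A + limn B).
  have lim_AB : c * (A j + B (j + C)) @[j --> \oo] --> c * (limn A + limn B).
    apply: cvgM; first exact: cvg_cst.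
    apply: cvgD; first exact: is_cvg_cp_pos.
    by have := is_cvg_cp_neg; rewrite -(cvg_shiftn C).
  rewrite -[X in _ --> X]add0r -[X in X @ _](_ : (fun j =>
    (v j / p%:R ^+ j - c * (A j + B (j + C))) + c * (A j + B (j + C))) = _); last first.
    by apply/funext => j; rewrite subrK.
  apply: cvgD lim_AB; apply/norm_cvg0P.
  apply: (squeeze_cvgr _ (cvg_cst 0) (cvg_linear_div_expr 8 (4 * C%:R))).
  by apply: nearW => j; rewrite normr_ge0 err.
have cp0 := cp_gt0; have xcp : limn A + limn B = x * cp p x.
  by rewrite /cp mulVKf // gt_eqF.
have d0 : 0 < c * x * cp p x by rewrite mulr_gt0 // mulr_gt0.
(* Divided by p^j, numerator and denominator both tend to c x c_p(x), which is nonzero. *)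
rewrite -[X in _ --> X](divff (lt0r_neq0 d0)).
rewrite xcp mulrA in lim_v.
have -> : (fun j => v j / (c * (k j)%:R * cp p x)) =
    (fun j => v j / p%:R ^+ j / (c * ((k j)%:R / p%:R ^+ j) * cp p x)).
  apply/funext => j; rewrite -[RHS]mulrA -invfM; congr (_ / _).
  by field; rewrite gt_eqF.
apply: cvgM lim_v _; apply: cvgV; first exact: lt0r_neq0.
by apply: cvgM (cvg_cst _); apply: cvgM cvg_kseq; exact: cvg_cst.
Qed.

(** Reduces each family to its level sums: [w n q] is the contribution of the power q to the
    valuation at n, and c is 1 for U and 1/2 for O and Sp. *)
Lemma valuation_ratio_of_levels (c : R) (v : nat -> R) (w : nat -> nat -> R) :
  0 < c <= 1 ->
  (forall n L, (n * n < p ^ L.+1)%N -> (n.*2 < p ^ L.+1)%N ->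
     v n = \sum_(l < L) w n (p ^ l.+1)%N) ->
  (forall n q, odd q -> `|w n q - c * (q%:R * distZ (n%:R / q%:R) ^+ 2)| <= 3) ->
  v (k j) / (c * (k j)%:R * cp p x) @[j --> \oo] --> (1 : R).
Proof.
move=> c01 vE w_near; have [C xC] := exists_expn_ge.
apply: (cvg_valuation_ratio c C.*2) => // j.
have [kk k2] := kseq_bounds C j xC.
rewrite (vE _ _ kk k2) mulr_sumr -sumrB (le_trans (ler_norm_sum _ _ _)) //.
rewrite mulr_natr -[X in 3 *+ X]card_ord -sumr_const; apply: ler_sum => l _.
by rewrite -natrX w_near // oddX p_odd orbT.
Qed.
End Asymptotics.

Theorem theorem6p1 (R : realType) (p : nat) (x : R) :
  prime p -> odd p -> 0 < x ->
  [/\ (fun j : nat => (vp p (g_U R (kseq p x j)))%:~R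
                       / ((kseq p x j)%:R * cp p x)) @ \oo --> (1 : R),
      (fun j : nat => (vp p (g_O R (kseq p x j)))%:~R
                       / (2^-1 * (kseq p x j)%:R * cp p x)) @ \oo --> (1 : R) &
      (fun j : nat => (vp p (g_Sp R (kseq p x j)))%:~R
                       / (2^-1 * (kseq p x j)%:R * cp p x)) @ \oo --> (1 : R)].
Proof.
move=> pp op x0.
have half : 0 < (2^-1 : R) <= 1 by rewrite invr_gt0 ltr0n invf_le1 // ler1n.
split.
- under eq_fun do rewrite -[X in _ / (X * _)]mul1r.
  apply: (valuation_ratio_of_levels R p x pp op x0 1 (fun n => (vp p (g_U R n))%:~R)
    (fun n q => ((n * n) %/ q)%:R + (\sum_(i < n) i %/ q)%:R - (\sum_(i < n) (n + i) %/ q)%:R)).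
  + by rewrite ltr01 lexx.
  + by move=> n L; exact: vp_g_U.
  + by move=> n q /odd_gt0; rewrite mul1r; exact: level_estimate_U.
- apply: (valuation_ratio_of_levels R p x pp op x0 _ (fun n => (vp p (g_O R n))%:~R)
    (fun n q => ((n * n.-1)./2 %/ q)%:R - (\sum_(i < n) (i.*2 %/ q - i %/ q))%:R) half).
  (* The bound on n^2 also covers n(n-1)/2 and, in the symplectic case below, n(n+1)/2. *)
  + move=> n L nL; apply: vp_g_O => //; apply: leq_ltn_trans nL.
    by case: n => // n /=; rewrite mulnS; move: (n.+1 * n)%N; clear; lia.
  + exact: level_estimate_O.
- apply: (valuation_ratio_of_levels R p x pp op x0 _ (fun n => (vp p (g_Sp R n))%:~R)
    (fun n q => ((n * n.+1)./2 %/ q)%:R - (\sum_(i < n.+1) (i.*2 %/ q - i %/ q))%:R) half).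
  + move=> n L nL; apply: vp_g_Sp => //; apply: leq_ltn_trans nL.
    case: n => // n; rewrite mulnS; have := leq_pmulr n.+1 (ltn0Sn n).
    by move: (_ * _)%N; clear; lia.
  + exact: level_estimate_Sp.
Qed.
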